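(* Let $p\geq 2$ be an even integer and let $d\geq 1$ be an integer. Then \[ e(\ell_p^d) \leq \begin{cases} \left(\tfrac{p}{2}-1\right)d+1 & \text{if } p\equiv 0 \pmod{4},\\ \tfrac{p}{2}d+1 & \text{if } p\equiv 2 \pmod{4}. \end{cases} \] In particular, $e(\ell_4^d)=d+1$.
   Context: For $1<p<\infty$ and an integer $d\geq 1$, $\ell_p^d$ denotes $\mathbb{R}^d$ endowed with the norm $\|x\|_p=\left(\sum_{i=1}^d|x_i|^p\right)^{1/p}$. A set $S\subset \ell_p^d$ is $\lambda$-equilateral ($\lambda>0$) if $\|x-y\|_p=\lambda$ for all distinct $x,y\in S$, and equilateral if it is $\lambda$-equilateral for some $\lambda>0$. The maximum number of elements in an equilateral set in $\ell_p^d$ is denoted by $e(\ell_p^d)$. *)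

(* Defs.v *)
From mathcomp Require Import all_boot all_order all_algebra.
From mathcomp Require Import all_classical all_reals all_analysis.

Set Implicit Arguments.
Unset Strict Implicit.
Unset Printing Implicit Defensive.

Import Order.TTheory GRing.Theory Num.Theory.

Local Open Scope classical_set_scope.
Local Open Scope ring_scope.

(* The norm that the library puts on 'rV[R]_d is the sup norm, so the p-norm
   is a separate function. It is meant for 1 < p. *)
Definition lp_norm (R : realType) (p : R) (d : nat) (x : 'rV[R]_d) : R :=
  (\sum_(i < d) `|x ord0 i| `^ p) `^ p^-1.

Definition lambda_equilateral (R : realType) (p : R) (d : nat) (lambda : R)
    (S : set 'rV[R]_d) : Prop :=
  forall x y, S x -> S y -> x <> y -> lp_norm p (x - y) = lambda.

Definition equilateral (R : realType) (p : R) (d : nat)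
    (S : set 'rV[R]_d) : Prop :=
  exists2 lambda : R, 0 < lambda & lambda_equilateral p lambda S.

(* [is_equilateral_max p d n] says that e(l_p^d) = n. Such an n is unique; the
   upper bound ranges over arbitrary sets S, infinite ones included. *)
Definition is_equilateral_max (R : realType) (p : R) (d n : nat) : Prop :=
  (exists2 S : set 'rV[R]_d, equilateral p S & (S #= `I_n)%card) /\
  (forall S : set 'rV[R]_d, equilateral p S -> (S #<= `I_n)%card).

(* Main.v *)
Require Import Defs.
From mathcomp Require Import all_boot all_order all_algebra.
From mathcomp Require Import all_classical all_reals all_analysis.
From mathcomp Require Import ring lra zify.

Import Order.TTheory GRing.Theory Num.Theory.

Local Open Scope ring_scope.

(** Upper bound. Put p = 2h and let a_1, ..., a_m be points at mutual distance
    lambda in l_p^d. If m > L d + 1, the L d + 1 homogeneous linear equations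
      sum_u x_u = 0,  sum_u x_u (a_u)_i ^ k = 0  (1 <= i <= d, 1 <= k <= L)
    have a solution x <> 0. The quadratic form
      Q = sum_(u, v) x_u x_v |a_u - a_v|_p ^ p
    is then computed in two ways.
    - Off the diagonal the distance is lambda, and sum_u x_u = 0, so that
      Q = - lambda ^ p sum_u x_u ^ 2 < 0.
    - As p is even, |a_u - a_v|_p ^ p is a polynomial in the coordinates. By the
      binomial theorem Q is the sum over i and k of
      (-1) ^ k 'C(p, k) M_(i, p - k) M_(i, k), where
      M_(i, k) = sum_u x_u (a_u)_i ^ k. One of k and p - k is less than h unless
      k = h, so if L >= h - 1 only the terms (-1) ^ h 'C(p, h) M_(i, h) ^ 2
      survive. They are nonnegative if h is even; if h is odd, L = h makes them
      vanish too. Either way Q >= 0, a contradiction.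
    Hence m <= (h - 1) d + 1 for even h and m <= h d + 1 for odd h. This is the
    content of [equidistant_size_le], which rests on [sum_subX_ge0] and
    [exists_vanishing_moments]. A uniform finite bound also shows that the
    maximum exists ([exists_equilateral_max]).

    Lower bound for p = 4. The standard basis vectors and a suitable point
    (t, ..., t) on the diagonal form an equilateral set of d + 1 points
    ([exists_equidistant_simplex]), which meets the upper bound with h = 2,
    L = 1. *)

(** * A quadratic form in the powers of differences *)

Lemma sum_subX_moments (R : comNzRingType) (I : finType) (x a : I -> R) (n : nat) :
  \sum_u \sum_v x u * x v * (a u - a v) ^+ n =
  \sum_(k < n.+1) (-1) ^+ k * 'C(n, k)%:R *
    (\sum_u x u * a u ^+ (n - k)) * (\sum_v x v * a v ^+ k).
Proof.
under eq_bigr do under eq_bigr do rewrite exprBn mulr_sumr.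
under eq_bigr do rewrite exchange_big.
rewrite exchange_big; apply: eq_bigr => k _ /=.
rewrite -mulrA mulr_suml mulr_sumr; apply: eq_bigr => u _.
rewrite !mulr_sumr; apply: eq_bigr => v _.
by rewrite -mulr_natl; ring.
Qed.

(** Vanishing of the moments up to L kills every term of the expansion except the
    middle one, k = h, whose sign is (-1) ^ h. The hypothesis on L asks for
    L >= h - 1 if h is even and for L >= h if h is odd: in the odd case the
    middle term has the wrong sign and its moment must vanish as well. *)
Lemma sum_subX_ge0 (R : realDomainType) (I : finType) (x a : I -> R) (h L : nat) :
  (h <= L + ~~ odd h)%N ->
  (forall k, (k <= L)%N -> \sum_u x u * a u ^+ k = 0) ->
  0 <= \sum_u \sum_v x u * x v * (a u - a v) ^+ h.*2.
Proof.
move=> hL M0; rewrite sum_subX_moments; apply: sumr_ge0 => k _.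
have [lt_kh | lt_hk | eq_kh] := ltngtP (k : nat) h.
- by rewrite (M0 k) ?mulr0 //; lia.
- by rewrite (M0 (h.*2 - k)%N) ?mulr0 ?mul0r //; have := ltn_ord k; lia.
rewrite eq_kh -addnn addnK; case: (boolP (odd h)) hL => odd_h hL.
  by rewrite (M0 h) ?mulr0 //; lia.
by rewrite -signr_odd (negbTE odd_h) mul1r -mulrA mulr_ge0 ?ler0n // -expr2 sqr_ge0.
Qed.

(** * The upper bound *)

(** Dimension count: the moments of order 0 are one equation shared by all
    coordinates, the moments of order 1, ..., L are L equations for each
    coordinate. *)
Lemma exists_vanishing_moments (F : fieldType) (d L m : nat)
    (a : 'I_m -> 'rV[F]_d) :
  (L * d + 1 < m)%N ->
  exists2 x : 'I_m -> F, (exists u, x u != 0) &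
    \sum_u x u = 0 /\
    forall (i : 'I_d) k, (k <= L)%N -> \sum_u x u * a u ord0 i ^+ k = 0.
Proof.
move=> lt_m.
(* Row u of A lists the monomials of degree at most L in single coordinates,
   evaluated at a u; a solution is a row vector of the left kernel. *)
pose A : 'M[F]_(m, 1 + d * L) := row_mx (const_mx 1)
  (\matrix_(u < m) mxvec (\matrix_(i < d, k < L) a u ord0 i ^+ k.+1)).
have kerA_neq0 : kermx A != 0.
  by rewrite kermx_eq0 /row_free neq_ltn (leq_ltn_trans (rank_leq_col A)) //; lia.
pose x := nz_row (kermx A).
have xA0 : x *m A = 0 by apply/sub_kermxP/nz_row_sub.
have sum_x : \sum_u x ord0 u = 0.
  have /rowP/(_ (lshift (d * L) ord0)) := xA0.
  rewrite mxE [RHS]mxE => xA_col; rewrite -[RHS]xA_col; apply: eq_bigr => u _.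
  by rewrite row_mxEl mxE mulr1.
exists (x ord0).
  apply/existsP; apply: contra_neqT kerA_neq0 => /existsPn x0.
  apply/eqP; rewrite -nz_row_eq0; apply/eqP/rowP => u.
  by have := x0 u; rewrite negbK mxE => /eqP.
split=> // i [_ | k lt_kL].
  by rewrite -[RHS]sum_x; apply: eq_bigr => u _; rewrite expr0 mulr1.
have /rowP/(_ (rshift 1 (mxvec_index i (Ordinal lt_kL)))) := xA0.
rewrite mxE [RHS]mxE => xA_col; rewrite -[RHS]xA_col; apply: eq_bigr => u _.
by rewrite row_mxEr mxE mxvecE mxE.
Qed.

(** The value of the form Q of the vanishing-moment weights on the matrix of p-th
    powers of distances is - c * sum x ^ 2 since that matrix is c (J - I), with J
    the all-ones matrix, which contradicts its nonnegativity. *)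
Lemma equidistant_size_le (R : realFieldType) (d h L m : nat)
    (a : 'I_m -> 'rV[R]_d) (c : R) :
  (0 < h)%N -> (h <= L + ~~ odd h)%N -> 0 < c ->
  (forall u v, u != v -> \sum_(i < d) (a u - a v) ord0 i ^+ h.*2 = c) ->
  (m <= L * d + 1)%N.
Proof.
move=> h_gt0 hL c_gt0 dist_a; rewrite leqNgt; apply/negP => lt_m.
have [x [w xw_neq0] [sum_x Mx]] := exists_vanishing_moments _ _ _ _ a lt_m.
pose Q := \sum_u \sum_v x u * x v * \sum_(i < d) (a u - a v) ord0 i ^+ h.*2.
have Q_ge0 : 0 <= Q.
  have -> : Q = \sum_(i < d) \sum_u \sum_v
      x u * x v * (a u ord0 i - a v ord0 i) ^+ h.*2.
    rewrite exchange_big; apply: eq_bigr => u _ /=.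
    rewrite exchange_big; apply: eq_bigr => v _ /=.
    by rewrite mulr_sumr; apply: eq_bigr => i _; rewrite !mxE.
  apply: sumr_ge0 => i _.
  by apply: (sum_subX_ge0 _ _ x (fun u => a u ord0 i) _ _ hL) => k; apply: Mx.
have QE : Q = - c * \sum_u x u ^+ 2.
  rewrite mulr_sumr; apply: eq_bigr => u _.
  have -> : - c * x u ^+ 2 = x u * c * (\sum_v x v) - c * x u ^+ 2.
    by rewrite sum_x; ring.
  rewrite [LHS](bigD1 u) //= [in RHS](bigD1 u) //=.
  rewrite [X in _ * X + _ = _]big1 => [|i _]; last first.
    by rewrite subrr mxE expr0n double_eq0; case: eqP h_gt0 => // ->.
  rewrite (eq_bigr (fun v => x u * c * x v)) => [|v v_neq_u].
    by rewrite -mulr_sumr; ring.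
  by rewrite dist_a 1?eq_sym //; ring.
have : 0 < \sum_u x u ^+ 2.
  rewrite (bigD1 w) //= ltr_pwDl ?exprn_even_gt0 //.
  by apply: sumr_ge0 => u _; rewrite sqr_ge0.
by move: Q_ge0; rewrite QE; nra.
Qed.

(** * An equilateral set of d + 1 points *)

Lemma sum_pred1 (R : nzSemiRingType) (d k : nat) :
  (k < d)%N -> \sum_(j < d) ((j : nat) == k)%:R = 1 :> R.
Proof.
move=> lt_kd; rewrite (bigD1 (Ordinal lt_kd)) //= eqxx big1 ?addr0 // => j.
by rewrite -val_eqE /= => /negbTE ->.
Qed.

(** Two basis vectors differ by 1 in absolute value at exactly two coordinates, so
    the p-th power of their distance is 2. A diagonal point (t, ..., t) is at the
    same distance from all of them if (1 - t) ^ p + (d - 1) t ^ p = 2. The left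
    side is 1 at t = 0 and at least 2 ^ p at t = -1, so such a t exists
    between -1 and 0. *)
Lemma exists_equidistant_simplex (R : rcfType) (d p : nat) :
  (0 < p)%N -> ~~ odd p -> (0 < d)%N ->
  exists s : nat -> 'rV[R]_d, forall k l, (k < d.+1)%N -> (l < d.+1)%N -> k != l ->
    \sum_(j < d) (s k - s l) ord0 j ^+ p = 2.
Proof.
move=> p_gt0 even_p d_gt0.
pose f : {poly R} := 2%:P - ((1 - 'X) ^+ p + d.-1%:R *: 'X ^+ p).
have fE t : f.[t] = 2 - ((1 - t) ^+ p + d.-1%:R * t ^+ p).
  by rewrite /f !hornerE.
have [t _ /rootP] : exists2 t : R, -1 <= t <= 0 & root f t.
  apply: poly_ivt; first by lra.
  rewrite !fE expr0n eqn0Ngt p_gt0 subr0 expr1n mulr0 opprK.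
  rewrite -signr_odd (negbTE even_p) expr0.
  have : 2 <= 2 ^+ p :> R by rewrite -{1}[2]expr1 ler_weXn2l // ler1n.
  have : 0 <= d.-1%:R :> R by apply: ler0n.
  by rewrite -[1 + 1]/(2 : R); lra.
rewrite fE => ft0.
(* Index d is the diagonal point, the indices below d are the basis vectors. *)
pose s k : 'rV[R]_d := \row_(j < d) if k == d then t else ((j : nat) == k)%:R.
have dist_s k l : (k < l)%N -> (l < d.+1)%N -> \sum_(j < d) (s k - s l) ord0 j ^+ p = 2.
  move=> lt_kl lt_ld; have lt_kd : (k < d)%N by lia.
  rewrite (eq_bigr (fun j : 'I_d => ((if k == d then t else ((j : nat) == k)%:R) -
    (if l == d then t else ((j : nat) == l)%:R)) ^+ p)); last first.
    by move=> j _; rewrite !mxE.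
  rewrite (ltn_eqF lt_kd); case: eqVneq => [_ | l_neq_d].
    rewrite (eq_bigr (fun j : 'I_d =>
      ((j : nat) == k)%:R * ((1 - t) ^+ p - t ^+ p) + t ^+ p)); last first.
      move=> j _; case: eqP => _ /=; first by ring.
      by rewrite sub0r exprNn -signr_odd (negbTE even_p); ring.
    rewrite big_split /= -mulr_suml sum_pred1 // sumr_const card_ord.
    rewrite -(prednK d_gt0) mulrS -mulr_natl; lra.
  rewrite (eq_bigr (fun j : 'I_d => ((j : nat) == k)%:R + ((j : nat) == l)%:R)).
    by rewrite big_split /= !sum_pred1 //; lia.
  move=> j _; have [-> | _] := eqVneq (j : nat) k.
    by rewrite (ltn_eqF lt_kl) subr0 expr1n addr0.
  rewrite sub0r exprNn -signr_odd (negbTE even_p) mul1r add0r.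
  by case: eqP => _; rewrite ?expr1n // expr0n eqn0Ngt p_gt0.
exists s => k l lt_k lt_l; rewrite neq_ltn => /orP[/dist_s -> // | /dist_s <- //].
apply: eq_bigr => j _; rewrite -opprB mxE exprNn -signr_odd (negbTE even_p).
by rewrite mul1r.
Qed.

(** * Equilateral sets in l_p^d for even p *)

Lemma lp_norm_even (R : realType) (p d : nat) (x : 'rV[R]_d) :
  ~~ odd p -> lp_norm p%:R x = (\sum_(i < d) x ord0 i ^+ p) `^ p%:R^-1.
Proof.
move=> even_p; congr (_ `^ _); apply: eq_bigr => i _.
by rewrite powR_mulrn // -normrX ger0_norm // exprn_even_ge0.
Qed.

Lemma lp_norm_evenX (R : realType) (p d : nat) (x : 'rV[R]_d) :
  (0 < p)%N -> ~~ odd p -> lp_norm p%:R x ^+ p = \sum_(i < d) x ord0 i ^+ p.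
Proof.
move=> p_gt0 even_p; rewrite lp_norm_even // -powR_mulrn ?powR_ge0 // -powRrM.
rewrite mulVf ?pnatr_eq0 -?lt0n // powRr1 //.
by apply: sumr_ge0 => i _; rewrite exprn_even_ge0.
Qed.

Local Open Scope card_scope.

(** Bounding the finite subsets bounds a set: an infinite set contains a copy of
    `I_N.+1. *)
Lemma card_le_I (T : Type) (S : set T) (N : nat) :
  (forall m, `I_m #<= S -> (m <= N)%N) -> S #<= `I_N.
Proof.
move=> leN; have [[n Sn] | /infiniteP inf_S] := pselect (finite_set S).
  move: Sn; rewrite card_eq_le => /andP[S_le_n n_le_S].
  by apply: card_le_trans S_le_n _; rewrite card_le_II leN.
have : `I_N.+1 #<= S by apply: card_le_trans (card_leT _) inf_S.
by move/leN; rewrite ltnn.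
Qed.

Lemma equilateral_card_le (R : realType) (d h L : nat) (S : set 'rV[R]_d) :
  (0 < h)%N -> (h <= L + ~~ odd h)%N -> equilateral h.*2%:R S ->
  S #<= `I_(L * d + 1).
Proof.
move=> h_gt0 hL [c c_gt0 dist_S]; apply: card_le_I => m /card_leP[f].
pose a (u : 'I_m) : 'rV[R]_d :=
  val (f (SigSub (mem_set (ltn_ord u : `I_m%classic (u : nat))))).
have aS u : S (a u) by rewrite /a; apply/set_mem/valP.
have a_inj : injective a.
  by move=> u v /val_inj /(@inj _ _ _ f) uv; apply/val_inj;
     apply: (congr1 val (uv _ _)); rewrite inE.
have p_gt0 : (0 < h.*2)%N by rewrite double_gt0.
apply: (equidistant_size_le R d h L m a (c ^+ h.*2)) => // [|u v u_neq_v].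
  exact: exprn_gt0.
rewrite -lp_norm_evenX ?odd_double // dist_S // => /a_inj uv.
by rewrite uv eqxx in u_neq_v.
Qed.

Lemma exists_equilateral_simplex (R : realType) (d p : nat) :
  (0 < p)%N -> ~~ odd p -> (0 < d)%N ->
  exists2 S : set 'rV[R]_d, equilateral p%:R S & S #= `I_(d + 1).
Proof.
move=> p_gt0 even_p d_gt0; rewrite addn1.
have [s dist_s] := exists_equidistant_simplex R _ _ p_gt0 even_p d_gt0.
exists (s @` `I_d.+1)%classic.
  exists (2 `^ p%:R^-1); first exact: powR_gt0.
  move=> _ _ [k k_lt <-] [l l_lt <-] skl; rewrite lp_norm_even // dist_s //.
  by apply/eqP => kl; apply: skl; rewrite kl.
apply: inj_card_eq => k l; rewrite !inE /= => k_lt l_lt skl.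
apply/eqP; apply: contraT => k_neq_l.
have := dist_s _ _ k_lt l_lt k_neq_l; rewrite skl subrr big1 => [/eqP|j _].
  by rewrite eq_sym pnatr_eq0.
by rewrite mxE expr0n eqn0Ngt p_gt0.
Qed.

Lemma exists_equilateral_max (R : realType) (p : R) (d N : nat) :
  (forall S : set 'rV[R]_d, equilateral p S -> S #<= `I_N) ->
  exists2 e, (e <= N)%N & is_equilateral_max p d e.
Proof.
move=> leN.
pose P e := `[< exists2 S : set 'rV[R]_d, equilateral p S & S #= `I_e >].
have P_leN e : P e -> (e <= N)%N.
  move=> /asboolP[S /leN S_le /card_eqPle[_ e_le_S]].
  by rewrite -card_le_II; apply: card_le_trans e_le_S S_le.
have exP : exists e, P e.
  exists 0%N; apply/asboolP; exists set0; last by rewrite II0 card_eq00.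
  by exists 1.
case: (ex_maxnP exP P_leN) => e Pe e_max; exists e; first exact: P_leN.
split=> [|S S_eq]; first exact/asboolP.
have [n Sn] := card_le_finite (leN S S_eq) (finite_II N).
move: (Sn); rewrite card_eq_le => /andP[S_le_n _].
apply: card_le_trans S_le_n _; rewrite card_le_II; apply: e_max.
by apply/asboolP; exists S.
Qed.

(** With h = p / 2, the least L allowed by the upper bound is h - 1 if h is even,
    that is p = 0 mod 4, and h if h is odd. *)
Theorem theorem1 (R : realType) :
  (forall p d : nat, (2 <= p)%N -> ~~ odd p -> (1 <= d)%N ->
     exists e : nat,
       [/\ is_equilateral_max (p%:R : R) d e,
           p = 0 %[mod 4] -> (e <= (p %/ 2 - 1) * d + 1)%N
         & p = 2 %[mod 4] -> (e <= p %/ 2 * d + 1)%N]) /\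
  (forall d : nat, (1 <= d)%N -> is_equilateral_max (4%:R : R) d (d + 1)).
Proof.
split=> [p d p_ge2 even_p d_gt0 | d d_gt0].
  have [h p_eq] : exists h, p = h.*2 by exists p./2; lia.
  have h_gt0 : (0 < h)%N by lia.
  subst p; pose L := (h - ~~ odd h)%N.
  have hL : (h <= L + ~~ odd h)%N by rewrite /L; lia.
  have [e e_le e_max] := exists_equilateral_max R h.*2%:R d _
    (fun S => equilateral_card_le R d h L S h_gt0 hL).
  exists e; split=> // h4; have half_p : (h.*2 %/ 2 = h)%N by lia.
  - by rewrite half_p; have <- : L = (h - 1)%N by rewrite /L; lia.
  - by rewrite half_p; have <- : L = h by rewrite /L; lia.
split; first exact: exists_equilateral_simplex.
by move=> S /(equilateral_card_le R d 2 1 S isT isT); rewrite mul1n.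
Qed.
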